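(* For every integer $n\ge 2$, define $$g_n := B_n^4-B_{n-1}^4-\left\lceil \frac{B_{2n-1}}{280}\right\rceil+\varepsilon_n,$$ where $\varepsilon_n=1$ if $B_{2n-1}\equiv 1\pmod{280}$ and $\varepsilon_n=0$ otherwise. Then for every integer $n\ge 2$, $$\left\lfloor\left(\sum_{k=n}^{\infty}\frac{1}{B_k^4}\right)^{-1}\right\rfloor = g_n.$$
   Context: The balancing numbers $(B_n)_{n\ge 0}$ are defined by $B_0=0$, $B_1=1$, and $B_n=6B_{n-1}-B_{n-2}$ for $n\ge 2$. Here $\lfloor\cdot\rfloor$ and $\lceil\cdot\rceil$ denote the floor and ceiling functions. *)

(* Defs.v *)
(* Stdlib reals with Coquelicot series. *)
From Stdlib Require Import Reals ZArith Zfloor.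
From Coquelicot Require Import Coquelicot.

Open Scope R_scope.

Fixpoint balancing (n : nat) : Z :=
  match n with
  | O => 0%Z
  | S m =>
      match m with
      | O => 1%Z
      | S k => (6 * balancing m - balancing k)%Z
      end
  end.

(* The subtractions [n - 1] and [2 * n - 1] on nat truncate only at [n = 0]. *)
Definition eps (n : nat) : Z :=
  if (balancing (2 * n - 1) mod 280 =? 1)%Z then 1%Z else 0%Z.

Definition g (n : nat) : Z :=
  (balancing n ^ 4 - balancing (n - 1) ^ 4
   - Zceil (IZR (balancing (2 * n - 1)) / 280) + eps n)%Z.

(* The sum of [a k] over [k >= n], with the index shifted to start at 0.
   [Series] returns 0 when the partial sums tend to infinity. *)
Definition tail_sum (a : nat -> R) (n : nat) : R :=
  Series (fun k => a (n + k)%nat).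

(* Main.v *)
Require Import Defs.
From Stdlib Require Import Reals ZArith Zfloor Lia Lra Psatz.
From Coquelicot Require Import Coquelicot.
Open Scope R_scope.

(** Write [b_k] for [balancing k]. The theorem compares the tail of the series
    with telescoping series built from

      F u k = approx u b_(k+1) b_k
            = b_(k+1)^4 - b_k^4 - (b_(k+1)^2 - b_k^2) / 280 + u,

    where [b_(k+1)^2 - b_k^2 = b_(2k+1)]. The number 280 is [8 * 35]: expanding
    the inverse of the tail in powers of [alpha = 3 + 2 sqrt 2], the term of
    order [alpha^(2n)] that [b_n^4 - b_(n-1)^4] misses is [b_(2n-1) / 8] times
    [- 1 / (alpha^2 + 1 + alpha^(-2)) = - 1 / 35]. The next term is a constant
    near 0.0058, and everything after it tends to 0. This leaves room to place
    the inverse of the tail between [F (1/280) (n-1)] and [F (1/10) (n-1)].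

    These two bounds are proved without any asymptotics. By the Cassini-type
    identity [b_(k+1)^2 - 6 b_(k+1) b_k + b_k^2 = 1], the quantities [F u k] and
    [F u (k+1)] are polynomials in [v = b_(k+1)^2] and
    [t = 6 b_(k+1) (3 b_(k+1) - b_k)], with [t^2 = 288 v^2 + 36 v]. Comparing
    [1 / b_(k+1)^4] with [1 / F u k - 1 / F u (k+1)] amounts to comparing
    [F u k * F u (k+1)] with [(F u (k+1) - F u k) * v^2]; there the terms of
    degree 4 and 3 in [v] cancel, and the sign of the quadratic remainder
    depends on [u] ([approx_mul_le], [approx_mul_ge]). Summing over [k] gives
    the bounds ([inv_tail_sum_bounds]).

    An interval of width about 1/10 determines the floor because [b_(2n-1)]
    avoids most residues modulo 280: it is odd, and it is 0, 1 or -1 modulo 35,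
    so its residue is 1 or at least 35 ([balancing_odd_residue]). The residue 1
    is where the lower constant 1/280 carries the value up to the next integer,
    which is the correction [eps]. *)

(** * Arithmetic of balancing numbers *)

Lemma balancing_SS (n : nat) :
  balancing (S (S n)) = (6 * balancing (S n) - balancing n)%Z.
Proof. reflexivity. Qed.

Lemma balancing_cassini (n : nat) :
  (balancing n ^ 2 - 6 * balancing n * balancing (S n)
   + balancing (S n) ^ 2 = 1)%Z.
Proof.
induction n as [|n IH]; [reflexivity|].
rewrite balancing_SS, <- IH; ring.
Qed.

(** The recurrence for [balancing (2 * n + 1)] also involves the next even
    index, so both formulas have to be carried through the induction. *)
Lemma balancing_double (n : nat) :
  (balancing (2 * n + 1) = balancing (S n) ^ 2 - balancing n ^ 2 /\
   balancing (2 * n + 2)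
   = balancing (S n) * (6 * balancing (S n) - 2 * balancing n))%Z.
Proof.
induction n as [|n [IH1 IH2]]; [split; reflexivity|].
replace (2 * S n + 2)%nat with (S (S (2 * n + 2))) by lia.
replace (2 * S n + 1)%nat with (S (2 * n + 2)) by lia.
rewrite (balancing_SS (2 * n + 2)).
replace (2 * n + 2)%nat with (S (2 * n + 1)) in * by lia.
rewrite (balancing_SS (2 * n + 1)), IH1, IH2, (balancing_SS n).
split; ring.
Qed.

Lemma balancing_growth (n : nat) :
  (Z.of_nat n <= balancing n /\ balancing n + 1 <= balancing (S n))%Z.
Proof.
induction n as [|n [IH1 IH2]]; [simpl; lia|].
rewrite balancing_SS; lia.
Qed.

Lemma balancing_ge_6 (k : nat) : (1 <= k)%nat -> (6 <= balancing (S k))%Z.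
Proof.
destruct k as [|k]; [lia|intros _].
rewrite balancing_SS; pose proof (balancing_growth k); lia.
Qed.

(** The odd-indexed terms satisfy [x_(n+1) = 34 x_n - x_(n-1)], which is
    [- x_n - x_(n-1)] modulo 35: from 1 and 0 the residues repeat as
    1, 0, -1. Parity comes from the same recurrence. *)
Lemma balancing_odd_mod (n : nat) :
  exists i j : Z,
    balancing (2 * n + 1) = (2 * i + 1)%Z /\
    (balancing (2 * n + 1) = 35 * j \/
     balancing (2 * n + 1) = 35 * j + 1 \/
     balancing (2 * n + 1) = 35 * j - 1)%Z.
Proof.
(* The possible pairs of consecutive residues modulo 35. *)
enough (H : exists i i' j j' : Z,
  (balancing (2 * n + 1) = 2 * i + 1 /\ balancing (2 * n + 3) = 2 * i' + 1 /\
   (balancing (2 * n + 1) = 35 * j + 1 /\ balancing (2 * n + 3) = 35 * j' \/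
    balancing (2 * n + 1) = 35 * j /\ balancing (2 * n + 3) = 35 * j' - 1 \/
    balancing (2 * n + 1) = 35 * j - 1 /\
    balancing (2 * n + 3) = 35 * j' + 1))%Z).
{ destruct H as (i & i' & j & j' & H). exists i, j; lia. }
induction n as [|n (i & i' & j & j' & H)].
{ exists 0%Z, 17%Z, 0%Z, 1%Z; simpl; lia. }
assert (Hrec : (balancing (2 * S n + 3)
          = 34 * balancing (2 * n + 3) - balancing (2 * n + 1))%Z).
{ replace (2 * S n + 3)%nat with (S (S (S (S (2 * n + 1))))) by lia.
  replace (2 * n + 3)%nat with (S (S (2 * n + 1))) by lia.
  rewrite !(balancing_SS (S _)), !balancing_SS; ring. }
rewrite Hrec; replace (2 * S n + 1)%nat with (2 * n + 3)%nat by lia.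
exists i', (34 * i' - i + 16)%Z, j'.
destruct H as (H1 & H2 & [H | [H | H]]).
- exists (34 * j' - j)%Z; lia.
- exists (34 * j' - j - 1)%Z; lia.
- exists (34 * j' - j + 1)%Z; lia.
Qed.

(** Below 35, only 0, 1 and 34 are 0, 1 or -1 modulo 35, and parity removes 0
    and 34. *)
Lemma balancing_odd_residue (n : nat) :
  (balancing (2 * n + 1) mod 280 = 1 \/
   35 <= balancing (2 * n + 1) mod 280)%Z.
Proof.
destruct (balancing_odd_mod n) as (i & j & Hi & Hj).
pose proof (Z.div_mod (balancing (2 * n + 1)) 280).
pose proof (Z.mod_pos_bound (balancing (2 * n + 1)) 280).
lia.
Qed.

(** * Polynomial inequalities for the telescoping terms *)

Definition approx (u x y : R) : R :=
  x ^ 4 - y ^ 4 - (x ^ 2 - y ^ 2) / 280 + u.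

Section Consecutive.

Variables a b : R.
Hypothesis cassini : a ^ 2 - 6 * a * b + b ^ 2 = 1.
Hypothesis a_ge0 : 0 <= a.
Hypothesis a_le_b : a <= b.
Hypothesis b_ge6 : 6 <= b.

Let v := b ^ 2.
Let t := 6 * b * (3 * b - a).

Let v_ge36 : 36 <= v.
Proof. unfold v; nra. Qed.

Let t_sqr : t ^ 2 = 288 * v ^ 2 + 36 * v.
Proof.
replace (t ^ 2) with (36 * b ^ 2 * (8 * b ^ 2 + (a ^ 2 - 6 * a * b + b ^ 2)))
  by (unfold t; ring).
rewrite cassini; unfold v; ring.
Qed.

(** [t] is close to [12 sqrt 2 * v], and [12 sqrt 2] is about 16.9706. The
    upper bound [17 v] amounts to [36 <= v]. *)
Let t_bounds : 16.97 * v <= t <= 17 * v.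
Proof.
assert (t_ge0 : 0 <= t) by (unfold t; nra).
split; nra.
Qed.

Let prev_sqr : a ^ 2 = 17 * v + 1 - t.
Proof. unfold t, v; lra. Qed.

Let next_sqr : (6 * b - a) ^ 2 = 17 * v + 1 + t.
Proof.
replace ((6 * b - a) ^ 2) with (36 * b ^ 2 - 12 * a * b + a ^ 2) by ring.
unfold t, v; lra.
Qed.

Let approx_prev (u : R) :
  approx u b a = v ^ 2 - (17 * v + 1 - t) ^ 2 - (v - (17 * v + 1 - t)) / 280 + u.
Proof. rewrite <- prev_sqr; unfold approx, v; field. Qed.

Let approx_next (u : R) :
  approx u (6 * b - a) b
  = (17 * v + 1 + t) ^ 2 - v ^ 2 - ((17 * v + 1 + t) - v) / 280 + u.
Proof. rewrite <- next_sqr; unfold approx, v; field. Qed.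

Lemma approx_ge (u : R) : 0 <= u -> b <= approx u b a.
Proof.
intros u_ge0.
assert (Ha : 0 <= a ^ 2 <= v / 2) by (rewrite prev_sqr; split; nra).
apply Rle_trans with v; [unfold v; nra|].
replace (approx u b a) with ((v - a ^ 2) * (v + a ^ 2 - 1 / 280) + u)
  by (unfold approx, v; field).
nra.
Qed.

Let approx_diff (u : R) :
  approx u (6 * b - a) b - approx u b a
  = 2 * (576 * v ^ 2 + (54 + 16 * (279 / 280)) * v + 279 / 280).
Proof.
rewrite approx_prev, approx_next.
field_simplify [t_sqr]; field.
Qed.

Lemma approx_le_next (u : R) : approx u b a <= approx u (6 * b - a) b.
Proof. pose proof (approx_diff u); nra. Qed.

(** With [m = 18 v + 279/280] and [P = 16 v + 1] the two factors are
    [u + t (m + P) -+ (t^2 + P m)], so their product is [u^2 + 2 u t (m + P)]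
    plus [(t^2 - P^2) (m^2 - t^2)]. *)
Let approx_mul (u : R) :
  approx u b a * approx u (6 * b - a) b
  = u ^ 2 + 2 * u * t * (34 * v + 559 / 280)
    + (32 * v ^ 2 + 4 * v - 1)
      * (36 * v ^ 2 - 36 / 280 * v + (279 / 280) ^ 2).
Proof.
set (X := u + t * (34 * v + 559 / 280)).
set (Y := 288 * v ^ 2 + 36 * v + (16 * v + 1) * (18 * v + 279 / 280)).
replace (approx u b a) with (X - Y)
  by (rewrite approx_prev; unfold X, Y; rewrite <- t_sqr; field).
replace (approx u (6 * b - a) b) with (X + Y)
  by (rewrite approx_next; unfold X, Y; rewrite <- t_sqr; field).
replace ((X - Y) * (X + Y)) with
  (u ^ 2 + 2 * u * t * (34 * v + 559 / 280)
   + t ^ 2 * (34 * v + 559 / 280) ^ 2 - Y ^ 2) by (unfold X; ring).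
rewrite t_sqr; unfold Y; field.
Qed.

(** The [v^2] terms of the left side minus the right side are about
    [- 6.74 v^2 + 68 u t v], where [t] is about [17 v]; the sign changes at
    [u] near 0.0058, and 1/280 is below that value. *)
Lemma approx_mul_le :
  approx (1 / 280) b a * approx (1 / 280) (6 * b - a) b
  <= (approx (1 / 280) (6 * b - a) b - approx (1 / 280) b a) * b ^ 4.
Proof.
rewrite approx_mul, approx_diff.
replace (b ^ 4) with (v ^ 2) by (unfold v; ring).
assert (t * v <= 17 * v * v) by nra.
nra.
Qed.

(** The same quadratic is positive for [u = 1/10]. The constant has
    to stay below [35/280 = 1/8] for the residues modulo 280 to determine the
    floor. *)
Lemma approx_mul_ge :
  (approx (1 / 10) (6 * b - a) b - approx (1 / 10) b a) * b ^ 4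
  <= approx (1 / 10) b a * approx (1 / 10) (6 * b - a) b.
Proof.
rewrite approx_mul, approx_diff.
replace (b ^ 4) with (v ^ 2) by (unfold v; ring).
assert (16.97 * v * v <= t * v) by nra.
nra.
Qed.

End Consecutive.

(** * Comparison with telescoping series *)

Lemma is_series_telescope (h : nat -> R) :
  is_lim_seq h 0 -> is_series (fun k => h k - h (S k)) (h 0%nat).
Proof.
intros Hh.
change (is_lim_seq (sum_n (fun k => h k - h (S k))) (h 0%nat)).
apply is_lim_seq_ext with (fun k => h 0%nat - h (S k)).
- intros k; induction k as [|k IH].
  + now rewrite sum_O.
  + rewrite sum_Sn, <- IH; unfold plus; simpl; ring.
- replace (h 0%nat) with (h 0%nat - 0) at 1 by ring.
  apply is_lim_seq_minus'; [apply is_lim_seq_const|].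
  now apply is_lim_seq_incr_1 in Hh.
Qed.

Lemma is_lim_seq_inv_of_ge (F : nat -> R) :
  (forall k, INR k <= F k) -> is_lim_seq (fun k => / F k) 0.
Proof.
intros HF.
apply (is_lim_seq_inv F p_infty); [|discriminate].
apply is_lim_seq_le_p_loc with INR; [|exact is_lim_seq_INR].
now exists 0%nat; intros k _.
Qed.

(** If [a k] is at most, respectively at least, [1 / F k - 1 / F (S k)] for all
    [k], its sum compares with [1 / F 0]. The hypotheses below are these
    inequalities with the positive denominators [a k] and [F k * F (S k)]
    exchanged, so that [F] occurs only polynomially. *)
Section InverseTelescope.

Variables a F : nat -> R.
Hypothesis F_gt0 : forall k, 0 < F k.
Hypothesis F_ge : forall k, INR k <= F k.

Let telescope :
  is_series (fun k => / F k - / F (S k)) (/ F 0%nat).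
Proof.
exact (is_series_telescope (fun k => / F k) (is_lim_seq_inv_of_ge F F_ge)).
Qed.

Let inv_diff k : / F k - / F (S k) = (F (S k) - F k) / (F k * F (S k)).
Proof. pose proof (F_gt0 k); pose proof (F_gt0 (S k)); field; lra. Qed.

Let mul_gt0 k : 0 < F k * F (S k).
Proof. now apply Rmult_lt_0_compat. Qed.

Lemma series_le_inv :
  (forall k, 0 < a k) ->
  (forall k, F k * F (S k) <= (F (S k) - F k) / a k) ->
  ex_series a /\ Series a <= / F 0%nat.
Proof.
intros a_gt0 H.
assert (Hle : forall k, 0 <= a k <= / F k - / F (S k)).
{ intros k; split; [now apply Rlt_le|].
  rewrite inv_diff; apply Rle_div_r; [apply mul_gt0|].
  rewrite Rmult_comm; apply Rle_div_r; [apply a_gt0|apply H]. }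
split.
- apply (@ex_series_le R_AbsRing R_CompleteNormedModule a
           (fun k => / F k - / F (S k))).
  + intros k; simpl; change (Rabs (a k) <= / F k - / F (S k)).
    rewrite Rabs_pos_eq; apply Hle.
  + eexists; exact telescope.
- rewrite <- (is_series_unique _ _ telescope).
  apply Series_le; [exact Hle|eexists; exact telescope].
Qed.

Lemma inv_le_series :
  ex_series a -> (forall k, 0 < a k) ->
  (forall k, F k <= F (S k)) ->
  (forall k, (F (S k) - F k) / a k <= F k * F (S k)) ->
  / F 0%nat <= Series a.
Proof.
intros a_sum a_gt0 F_incr H.
rewrite <- (is_series_unique _ _ telescope).
apply Series_le; [intros k|exact a_sum].
rewrite inv_diff; split.
- apply Rdiv_le_0_compat; [|apply mul_gt0].
  pose proof (F_incr k); lra.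
- apply Rle_div_l; [apply mul_gt0|].
  rewrite Rmult_comm; apply Rle_div_l; [apply a_gt0|apply H].
Qed.

End InverseTelescope.

(** * The inverse of the tail sum *)

Lemma balancing_consecutive (k : nat) :
  (1 <= k)%nat ->
  IZR (balancing k) ^ 2 - 6 * IZR (balancing k) * IZR (balancing (S k))
  + IZR (balancing (S k)) ^ 2 = 1 /\
  0 <= IZR (balancing k) <= IZR (balancing (S k)) /\
  6 <= IZR (balancing (S k)) /\
  IZR (balancing (S (S k))) = 6 * IZR (balancing (S k)) - IZR (balancing k).
Proof.
intros Hk; pose proof (balancing_growth k); pose proof (balancing_ge_6 k Hk).
repeat split.
- rewrite !pow_IZR, <- !mult_IZR, <- minus_IZR, <- plus_IZR.
  apply f_equal, balancing_cassini.
- apply IZR_le; lia.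
- apply IZR_le; lia.
- now apply IZR_le.
- now rewrite balancing_SS, minus_IZR, mult_IZR.
Qed.

Lemma inv_tail_sum_bounds (p : nat) :
  (1 <= p)%nat ->
  approx (1 / 280) (IZR (balancing (S p))) (IZR (balancing p))
  <= / tail_sum (fun k => 1 / IZR (balancing k) ^ 4) (S p)
  <= approx (1 / 10) (IZR (balancing (S p))) (IZR (balancing p)).
Proof.
intros Hp.
set (x := fun k => IZR (balancing (k + p))).
set (F := fun u k => approx u (x (S k)) (x k)).
set (a := fun k => 1 / x (S k) ^ 4).
assert (Hx : forall k, x k ^ 2 - 6 * x k * x (S k) + x (S k) ^ 2 = 1 /\
          0 <= x k <= x (S k) /\ 6 <= x (S k) /\
          x (S (S k)) = 6 * x (S k) - x k).
{ intros k; apply balancing_consecutive; lia. }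
assert (Hb : forall u k, 0 <= u -> x (S k) <= F u k).
{ intros u k Hu; destruct (Hx k) as (H1 & H2 & H3 & _).
  now apply approx_ge. }
assert (Hgt0 : forall u k, 0 <= u -> 0 < F u k).
{ intros u k Hu; pose proof (Hb u k Hu); pose proof (Hx k); lra. }
assert (Hge : forall u k, 0 <= u -> INR k <= F u k).
{ intros u k Hu; apply Rle_trans with (x (S k)); [|now apply Hb].
  rewrite INR_IZR_INZ; apply IZR_le.
  pose proof (balancing_growth (S k + p)); lia. }
assert (Ha : forall k, 0 < a k).
{ intros k; apply Rdiv_lt_0_compat; [lra|apply pow_lt].
  pose proof (Hx k); lra. }
assert (Hdiv : forall y k, y / a k = y * x (S k) ^ 4).
{ intros y k; unfold a; field; pose proof (Hx k); lra. }
destruct (series_le_inv a (F (1 / 280))) as [Hex Hup];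
  [intros k; apply Hgt0; lra|intros k; apply Hge; lra|exact Ha| |].
{ intros k; rewrite Hdiv; unfold F.
  destruct (Hx k) as (H1 & H2 & H3 & ->); now apply approx_mul_le. }
assert (Hlo : / F (1 / 10) 0%nat <= Series a).
{ apply inv_le_series;
    [intros k; apply Hgt0; lra|intros k; apply Hge; lra|exact Hex|exact Ha| |].
  - intros k; unfold F.
    destruct (Hx k) as (H1 & H2 & H3 & ->); now apply approx_le_next.
  - intros k; rewrite Hdiv; unfold F.
    destruct (Hx k) as (H1 & H2 & H3 & ->); now apply approx_mul_ge. }
replace (tail_sum (fun k => 1 / IZR (balancing k) ^ 4) (S p)) with (Series a).
2: { unfold tail_sum; apply Series_ext; intros k; unfold a, x.
     now replace (S p + k)%nat with (S k + p)%nat by lia. }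
change (F (1 / 280) 0%nat <= / Series a <= F (1 / 10) 0%nat).
assert (H1 : 0 < / F (1 / 10) 0%nat) by (apply Rinv_0_lt_compat, Hgt0; lra).
split.
- rewrite <- (Rinv_inv (F (1 / 280) 0%nat)).
  apply Rinv_le_contravar; lra.
- rewrite <- (Rinv_inv (F (1 / 10) 0%nat)).
  now apply Rinv_le_contravar.
Qed.

(** * Taking the floor *)

Theorem theorem1p1 (n : nat) (hn : (2 <= n)%nat) :
  Zfloor (/ tail_sum (fun k => 1 / IZR (balancing k) ^ 4) n) = g n.
Proof.
destruct n as [|p]; [lia|].
assert (Hbd := inv_tail_sum_bounds p ltac:(lia)).
unfold g, eps.
replace (2 * S p - 1)%nat with (2 * p + 1)%nat by lia.
replace (S p - 1)%nat with p by lia.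
destruct (balancing_double p) as [Hd _].
pose proof (balancing_odd_residue p) as Hres.
set (D := balancing (2 * p + 1)) in *.
set (q := (D / 280)%Z); set (r := (D mod 280)%Z) in *.
assert (HD : IZR D = 280 * IZR q + IZR r).
{ rewrite <- mult_IZR, <- plus_IZR; apply f_equal, Z.div_mod; lia. }
assert (Hr : (r < 280)%Z) by (apply Z.mod_pos_bound; lia).
assert (Hr' : 1 <= IZR r <= 279) by (split; apply IZR_le; lia).
assert (Hceil : Zceil (IZR D / 280) = (q + 1)%Z).
{ apply Zceil_eq; rewrite plus_IZR, HD; lra. }
rewrite Hceil.
unfold approx in Hbd.
rewrite !(pow_IZR _ 2), <- (minus_IZR (_ ^ _)), !pow_IZR in Hbd.
simpl Z.of_nat in Hbd.
rewrite <- Hd, HD in Hbd.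
apply Zfloor_eq; rewrite plus_IZR, !minus_IZR, plus_IZR.
destruct (Z.eqb_spec r 1) as [Hr1 | Hr1].
- rewrite Hr1 in Hbd; lra.
- assert (35 <= IZR r) by (apply IZR_le; lia); lra.
Qed.
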